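(* Let $X$ be a complete toric surface with singularity content $(n,\mathcal{B})$. Then the Hilbert series of $X$ admits a decomposition $$\mathrm{Hilb}(X,-K_X)=\frac{1+(K_X^2-2)t+t^2}{(1-t)^3}+\sum_{\sigma\in\mathcal{B}}Q_\sigma(t),\qquad\text{where}\quad Q_{\frac1r(a,b)}:=\frac{\sum_{i=0}^{r-1}\left(\delta_{(a+b)i}-\delta_0\right)t^i}{1-t^r},$$ and $\delta_m$ denotes the $m$-th Dedekind sum of $\frac1r(a,b)$.
   Context: $\mathrm{Hilb}(X,-K_X):=\sum_{k\geq0}h^0(X,-kK_X)\,t^k$. For $m\in\mathbb{Z}_{\geq0}$, the $m$-th Dedekind sum of the cyclic quotient singularity $\frac1r(a,b)$ is $$\delta_m:=\frac1r\sum\frac{\varepsilon^m}{(1-\varepsilon^a)(1-\varepsilon^b)},$$ where the summation is over those $r$-th roots of unity $\varepsilon\in\mu_r$ satisfying $\varepsilon^a\neq1$ and $\varepsilon^b\neq1$. Singularity content. Let $N$ be a rank-two lattice and let $\Sigma$ be the complete fan in $N_{\mathbb{Q}}=N\otimes_{\mathbb{Z}}\mathbb{Q}$ of $X$, with two-dimensional cones $C_1,\ldots,C_s$ numbered cyclically. For a two-dimensional cone $C$ whose rays have primitive lattice generators $u,v$, the width $w$ is the lattice length of $v-u$ and the local index $\ell$ is the lattice height of the line segment $uv$ above the origin. Let $C$ have singularity type $\frac1r(1,a-1)$, i.e. the corresponding affine toric surface is the quotient of $\mathbb{A}^2$ by $\mu_r$ acting with weights $1,a-1$, where $\gcd(r,a-1)=1$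 (smooth cones have $r=1$). Write $w=n_C\ell+\rho$ with $n_C,\rho$ non-negative integers and $0\leq\rho<\ell$. The residue of $C$ is $\mathrm{res}(C):=\frac{1}{\rho\ell}\left(1,\frac{\rho a}{w}-1\right)$ if $\rho\neq0$, and $\mathrm{res}(C):=\varnothing$ if $\rho=0$. The singularity content of $X$ is the pair $(n,\mathcal{B})$, where $n:=\sum_{i=1}^s n_{C_i}$ and $\mathcal{B}$ is the cyclically ordered list $\{\mathrm{res}(C_1),\ldots,\mathrm{res}(C_s)\}$ with the empty residues omitted.
   Formalization: Assumes −K_X nef (false without it: the Hirzebruch surface F_4 has h^0(−K)=10, formula gives 9), and the t^i coefficient of Q is δ_{(a+b)(i+1)}−δ_0 in place of δ_{(a+b)i}−δ_0 (as printed it fails for P(1,1,3): h^0(−K)=9, not 28/3). *)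

(* Defs.v *)
From HB Require Import structures.
From mathcomp Require Import all_boot all_order all_algebra all_field.
From mathcomp Require Import finmap boolp classical_sets functions cardinality.
From mathcomp Require Import fsbigop.

Set Implicit Arguments.
Unset Strict Implicit.
Unset Printing Implicit Defensive.

Import Order.TTheory GRing.Theory Num.Theory.

Local Open Scope classical_set_scope.
Local Open Scope ring_scope.

(* After a choice of basis, N is the lattice 'rV[int]_2 of row vectors and its
   dual M is the lattice 'cV[int]_2 of column vectors. *)

Definition pairing (R : pzRingType) (m : 'cV[R]_2) (x : 'rV[R]_2) : R :=
  (x *m m) 0 0.

Definition toQ (x : 'rV[int]_2) : 'rV[rat]_2 := map_mx intr x.

Definition det2 (u v : 'rV[int]_2) : int := u 0 0 * v 0 1 - u 0 1 * v 0 0.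

Definition lattice_length (x : 'rV[int]_2) : nat := gcdn `|x 0 0| `|x 0 1|.

Definition primitive (x : 'rV[int]_2) : Prop := lattice_length x = 1%N.

Definition cone (u v : 'rV[int]_2) : set 'rV[rat]_2 :=
  [set x | exists a b : rat, [/\ 0 <= a, 0 <= b & x = a *: toQ u + b *: toQ v]].

Definition is_face (F C : set 'rV[rat]_2) : Prop :=
  exists m : 'cV[rat]_2,
    (forall x, C x -> 0 <= pairing m x) /\ F = C `&` [set x | pairing m x = 0].

(* A complete toric surface, given by its fan: the two-dimensional cones are
   cone (ray i) (ray (ordS i)), where ordS is the cyclic successor, so that the
   rays are listed counterclockwise. *)
Record toric_surface := ToricSurface {
  nrays : nat;
  ray : 'I_nrays -> 'rV[int]_2;
  ray_inj : injective ray;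
  ray_primitive : forall i, primitive (ray i);
  ray_det : forall i, 0 < det2 (ray i) (ray (ordS i));
  fan_faces : forall i j,
    is_face (cone (ray i) (ray (ordS i)) `&` cone (ray j) (ray (ordS j)))
            (cone (ray i) (ray (ordS i)));
  fan_complete : forall x, exists i, cone (ray i) (ray (ordS i)) x
}.

Arguments ray : clear implicits.

(* Torus-invariant Weil divisors: D stands for \sum_i D i *: D_i, with D_i the
   closure of the orbit of the i-th ray. *)
Definition tdivisor (X : toric_surface) := {ffun 'I_(nrays X) -> int}.

Definition prime_divisor (X : toric_surface) (i : 'I_(nrays X)) : tdivisor X :=
  [ffun j => (j == i)%:Z].

Definition canonical_divisor (X : toric_surface) : tdivisor X := [ffun=> - 1].

(* H^0(X, O(D)) has as a basis the characters chi^m with div(chi^m) + D >= 0;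
   chi^m vanishes along D_i to the order pairing m (ray X i). The set of these
   m is finite because the fan is complete. *)
Definition h0 (X : toric_surface) (D : tdivisor X) : nat :=
  #|` fset_set [set m : 'cV[int]_2 | forall i, 0 <= pairing m (ray X i) + D i]|.

(* Intersection numbers of the D_i: 1 / (index of the cone) for two rays
   spanning a cone, 0 for two distinct rays not spanning a cone. The
   self-intersections follow from (\sum_j pairing m (ray X j) *: D_j) . D_i = 0,
   which reads, with u, v, w the rays ord_pred i, i, ordS i and for all m,
     pairing m u / det2 u v + pairing m v * (D_i . D_i)
       + pairing m w / det2 v w = 0. *)
Definition prime_intersection (X : toric_surface) (i j : 'I_(nrays X)) : rat :=
  if j == i then
    - (det2 (ray X (ord_pred i)) (ray X (ordS i)))%:~R
      / ((det2 (ray X (ord_pred i)) (ray X i))%:~R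
         * (det2 (ray X i) (ray X (ordS i)))%:~R)
  else if j == ordS i then (det2 (ray X i) (ray X j))%:~R^-1
  else if i == ordS j then (det2 (ray X j) (ray X i))%:~R^-1
  else 0.

Definition intersection (X : toric_surface) (D E : tdivisor X) : rat :=
  \sum_i \sum_j (D i)%:~R * (E j)%:~R * prime_intersection i j.

(* The D_i generate the cone of curves of X. *)
Definition nef (X : toric_surface) (D : tdivisor X) : Prop :=
  forall i, 0 <= intersection D (prime_divisor i).

Definition width (u v : 'rV[int]_2) : nat := lattice_length (v - u).

(* The primitive element of M that is constant on the line through u and v,
   up to sign. *)
Definition edge_normal (u v : 'rV[int]_2) : 'cV[int]_2 :=
  let w := (width u v)%:Z in
  let dx := (v - u) 0 0 in
  let dy := (v - u) 0 1 in
  \col_(i < 2) (if i == 0 then (dy %/ w)%Z else - (dx %/ w)%Z).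

Definition local_index (u v : 'rV[int]_2) : nat :=
  `|pairing (edge_normal u v) u|%N.

(* The quotient singularity 1/r (a, b). *)
Record quotient_singularity := QuotientSingularity {
  qs_order : nat;
  qs_weight1 : int;
  qs_weight2 : int
}.

(* The quotient of A^2 by mu_r with weights a, b is the affine toric surface of
   the positive quadrant with respect to the lattice Z^2 + Z (a, b) / r. *)
Definition quotient_presentation (s : quotient_singularity)
    (u v : 'rV[int]_2) : Prop :=
  exists y : 'rV[int]_2,
    (qs_order s)%:Z *: y = qs_weight1 s *: u + qs_weight2 s *: v /\
    forall x : 'rV[int]_2, exists c d e : int, x = c *: u + d *: v + e *: y.

(* The coordinates of A^2 may correspond to the two rays in either order. *)
Definition has_singularity_type (u v : 'rV[int]_2) (r : nat) (a : int) : Prop :=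
  let s := QuotientSingularity r 1 (a - 1) in
  [/\ (0 < r)%N, coprimez r%:Z (a - 1)
    & quotient_presentation s u v \/ quotient_presentation s v u].

Definition multiplicity (u v : 'rV[int]_2) : nat :=
  (width u v %/ local_index u v)%N.

(* The quotient a / w is exact: w = gcd(r, a) for a cone of type 1/r (1, a - 1).
   Changing a modulo r changes the second weight modulo the order. *)
Definition residue (u v : 'rV[int]_2) (a : int) : option quotient_singularity :=
  let w := width u v in
  let l := local_index u v in
  let rho := (w %% l)%N in
  if rho == 0%N then None
  else Some (QuotientSingularity (rho * l) 1 ((rho%:Z * a %/ w%:Z)%Z - 1)).

Definition singularity_content (X : toric_surface) (n : nat)
    (B : seq quotient_singularity) : Prop :=
  exists (r : 'I_(nrays X) -> nat) (a : 'I_(nrays X) -> int),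
    [/\ forall i, has_singularity_type (ray X i) (ray X (ordS i)) (r i) (a i),
        n = (\sum_i multiplicity (ray X i) (ray X (ordS i)))%N
      & B = pmap (fun i => residue (ray X i) (ray X (ordS i)) (a i))
                 (enum 'I_(nrays X))].

(* The weights are arbitrary integers, whence the integer exponents. *)
Definition dedekind_sum (s : quotient_singularity) (m : int) : algC :=
  let r := qs_order s in
  let a := qs_weight1 s in
  let b := qs_weight2 s in
  r%:R^-1 *
  \sum_(e \in [set e : algC | [/\ e ^+ r = 1, e ^ a != 1 & e ^ b != 1]])
     (e ^ m / ((1 - e ^ a) * (1 - e ^ b))).

Definition hilbert_coef (X : toric_surface) (D : tdivisor X) (k : nat) : nat :=
  h0 (D *+ k).

Notation "x %:F" := (@FracField.tofrac _ x) : ring_scope.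

(* The formal power series \sum_k c k * t^k is the expansion at t = 0 of the
   rational function f. *)
Definition expansion_at0 (F : fieldType) (c : nat -> F)
    (f : {fraction {poly F}}) : Prop :=
  exists p q : {poly F},
    [/\ q`_0 != 0, f = p%:F / q%:F
      & forall k, \sum_(i < k.+1) q`_i * c (k - i)%N = p`_k].

(* The coefficient of t^i is delta_((a + b)(i + 1)) - delta_0, which equals
   delta_(-(a + b) i) - delta_0, because the substitution of e^-1 for e gives
   delta_m = delta_(a + b - m). The index is not (a + b) i: the coefficient
   of t would then always be delta_(a + b) - delta_0 = 0. *)
Definition Qpart (s : quotient_singularity) : {fraction {poly algC}} :=
  let r := qs_order s in
  let c := qs_weight1 s + qs_weight2 s in
  (\sum_(i < r) (dedekind_sum s (c * i.+1%:Z) - dedekind_sum s 0) *: 'X^i)%:F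
    / (1 - 'X^r)%:F.

(* Main.v *)
Require Import Defs.
From HB Require Import structures.
From mathcomp Require Import all_boot all_order all_algebra all_field.
From mathcomp Require Import finmap boolp classical_sets cardinality fsbigop.
From mathcomp Require Import zify ring.

Set Implicit Arguments.
Unset Strict Implicit.
Unset Printing Implicit Defensive.

Import Order.TTheory GRing.Theory Num.Theory.
Local Open Scope ring_scope.

(** Write [P] for the polygon of the divisor [- K], cut out by the inequalities
    [pairing m (ray i) >= -1], so that [h0 (- k K)] counts the lattice points of
    [k P]. All the facets of [P] are at height [1], hence a lattice point of [k P]
    outside [(k - 1) P] lies on the boundary of [k P], and counting the points of [k P]
    reduces to counting those of the boundaries of the [j P] for [j <= k]
    ([mem_polygon_points]).

    That these boundaries decompose into the edges dual to the rays is where nefness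
    enters: locally it says that consecutive edges bound a convex region, and a Sturm
    comparison along the rays ([left_bound], [right_bound]) makes this global. The
    number of lattice points of a half-open edge is the difference of the integral parts of
    the coordinates of its end points, that is, its length plus a difference of two
    fractional parts. The lengths add up to [j K^2]. Each vertex is dual to a cone and
    lies on two edges, so the fractional parts regroup into one contribution
    [cone_contribution j i] for each cone ([h0_cone_contributions]).

    On the other side, for a singularity of type [1/r (1, b)] the difference of the
    Dedekind sums of indices [m + (1 + b)] and [m] is a difference of two sawtooth
    functions ([dedekind_sum_step]). With [m = (1 + b) k] it has the shape of the
    contribution of a cone. The contribution of a cone depends on its width only modulo
    its local index, so it may be computed on the residue ([residue_fparts]), and it
    vanishes if the residue is empty. Summing over [j <= k], the contributions of a cone
    telescope to the coefficient of [t^k] in the expansion of the function [Qpart] of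
    its residue, while [1 + K^2 k (k + 1) / 2] is the coefficient of [t^k] in the
    remaining term of the formula. *)

(** * The lattice plane *)

Lemma row2_eq (R : Type) (u v : 'rV[R]_2) :
  u 0 0 = v 0 0 -> u 0 1 = v 0 1 -> u = v.
Proof.
move=> e0 e1; apply/rowP => j.
case: (unliftP 0 j) => [j'|] ->; last exact: e0.
by rewrite (ord1 j') (_ : lift _ _ = 1) //; apply/val_inj.
Qed.

Lemma pairingE (R : pzRingType) (m : 'cV[R]_2) (x : 'rV[R]_2) :
  pairing m x = x 0 0 * m 0 0 + x 0 1 * m 1 0.
Proof.
rewrite /pairing mxE big_ord_recl big_ord1 (_ : lift _ _ = 1) //.
exact/val_inj.
Qed.

Lemma det2C u v : det2 u v = - det2 v u.
Proof. by rewrite /det2; ring. Qed.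

Lemma det2vv u : det2 u u = 0.
Proof. by rewrite /det2; ring. Qed.

(** Any three vectors of the plane satisfy Cramer's linear relation. *)
Lemma det2_pairing (m : 'cV[int]_2) u v w :
  pairing m u * det2 v w - pairing m v * det2 u w + pairing m w * det2 u v = 0.
Proof. by rewrite !pairingE /det2; ring. Qed.

Lemma det2_plucker x u v w :
  det2 x u * det2 v w - det2 x v * det2 u w + det2 x w * det2 u v = 0.
Proof. by rewrite /det2; ring. Qed.

(** A Bezout vector: it completes a primitive vector to a positively oriented
    basis. *)
Definition complement (u : 'rV[int]_2) : 'rV[int]_2 :=
  \row_j (if j == 0 then - (egcdz (u 0 0) (u 0 1)).2
          else (egcdz (u 0 0) (u 0 1)).1).

Lemma det2_complement u : primitive u -> det2 u (complement u) = 1.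
Proof.
rewrite /primitive /lattice_length /det2 !mxE /= => prim_u.
case: egcdzP => a b bezout _ /=.
move: bezout; rewrite /gcdz prim_u => bezout.
by rewrite -[RHS]bezout; ring.
Qed.

(** The point of the dual lattice with prescribed coordinates [s], [t] on the
    basis [u], [y]. *)
Definition dual_point (u y : 'rV[int]_2) (s t : int) : 'cV[int]_2 :=
  \col_i (if i == 0 then s * y 0 1 - t * u 0 1 else t * u 0 0 - s * y 0 0).

Lemma pairing_dual_point u y s t : det2 u y = 1 ->
  forall x, pairing (dual_point u y s t) x = s * det2 x y + t * det2 u x.
Proof. by move=> uy x; rewrite pairingE !mxE /= /det2; ring. Qed.

Lemma dual_point_pairing u y m : det2 u y = 1 ->
  dual_point u y (pairing m u) (pairing m y) = m.
Proof.
move=> uy; apply: trmx_inj; apply: row2_eq; rewrite !mxE /= !pairingE.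
  by rewrite -[RHS]mulr1 -uy /det2; ring.
by rewrite -[RHS]mulr1 -uy /det2; ring.
Qed.

Lemma primitive_collinear u v : primitive u -> primitive v -> det2 u v = 0 ->
  v = u \/ v = - u.
Proof.
move=> prim_u prim_v uv0.
have uy := det2_complement prim_u; have vz := det2_complement prim_v.
set y := complement u in uy; set z := complement v in vz.
have vE : v = det2 v y *: u.
  apply: row2_eq; rewrite !mxE -[LHS]mulr1 -uy.
    by rewrite -[LHS]addr0 -(mulr0 (- y 0 0)) -uv0 /det2; ring.
  by rewrite -[LHS]addr0 -(mulr0 (- y 0 1)) -uv0 /det2; ring.
have unit_p : det2 v y * det2 u z = 1.
  by rewrite -vz {2}vE /det2 !mxE; ring.
have := congr1 absz unit_p; rewrite abszM => /eqP.
rewrite muln_eq1 => /andP[/eqP abs1 _].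
have [p1|p1] : det2 v y = 1 \/ det2 v y = -1 by lia.
all: rewrite vE p1 ?scale1r ?scaleN1r; auto.
Qed.

(** * Sturm comparison along the rays of a fan *)

(** The determinants [d t] of a fixed ray with the [t]-th next ray satisfy a
    second order linear recurrence, and the values [h t] of a function whose
    associated divisor is nef satisfy the same recurrence as an inequality. The
    discrete Wronskian [h t.+1 * d t - h t * d t.+1] is then nonnegative, so
    that [h t / d t] increases as long as [d t] is positive. *)
Lemma sturm_comparison (d h D E : nat -> int) (N : nat) :
    d 0 = 0 -> h 0 = 0 -> 0 < d 1 ->
    (forall t, 0 < D t) ->
    (forall t, D t * d t.+2 + D t.+1 * d t = E t * d t.+1) ->
    (forall t, E t * h t.+1 <= D t * h t.+2 + D t.+1 * h t) ->
    (forall t, (t < N)%N -> 0 < d t.+1 -> t = 0 \/ 0 < d t) ->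
  forall t, (t <= N)%N -> 0 < d t -> h 1 * d t <= h t * d 1.
Proof.
move=> d0 h0 d1 D_gt0 d_rec h_rec d_pred.
suff main t : (t < N)%N -> 0 < d t.+1 ->
    0 <= h t.+1 * d t - h t * d t.+1 /\ h 1 * d t.+1 <= h t.+1 * d 1.
  by case=> [|t] tN; [rewrite d0 ltxx | move=> /(main t tN)[]].
elim: t => [|t IHt] tN dt2.
  by split; rewrite ?lexx // d0 h0 mulr0 mul0r subrr.
have dt1 : 0 < d t.+1 by case: (d_pred _ tN dt2).
have [wronskian bound] := IHt (ltnW tN) dt1.
have wronskian1 : 0 <= h t.+2 * d t.+1 - h t.+1 * d t.+2.
  rewrite -(pmulr_rge0 _ (D_gt0 t)).
  apply: le_trans (_ : D t.+1 * (h t.+1 * d t - h t * d t.+1) <= _).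
    by rewrite mulr_ge0 // ltW.
  have := d_rec t; have := h_rec t; move: (D t) (D t.+1) (E t) => Dt Dt1 Et.
  rewrite -(ler_pM2r dt1) => hr dr; rewrite -subr_ge0.
  rewrite -subr_ge0 in hr; apply: le_trans hr _.
  by rewrite mulrAC -dr le_eqVlt; apply/orP; left; apply/eqP; ring.
split=> //; rewrite -(ler_pM2r dt1).
apply: le_trans (_ : h t.+1 * d 1 * d t.+2 <= _).
  by rewrite mulrAC ler_pM2r.
by rewrite mulrAC [leRHS]mulrAC ler_pM2r // -subr_ge0.
Qed.

Lemma val_iter_ordS n (i : 'I_n) t : iter t (@ordS n) i = ((i + t) %% n)%N :> nat.
Proof.
elim: t => [|t IHt] /=; first by rewrite addn0 modn_small.
by rewrite IHt -addn1 modnDml addn1 addnS.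
Qed.

Lemma iter_ordS_surj n (i j : 'I_n) :
  exists2 t, (t < n)%N & j = iter t (@ordS n) i.
Proof.
exists ((j + (n - i)) %% n)%N; first by rewrite ltn_mod; case: n i j => [[]|].
apply: val_inj; rewrite /= val_iter_ordS modnDmr addnCA subnKC ?(ltnW (ltn_ord i)) //.
by rewrite modnDr modn_small.
Qed.

Lemma iter_ordS_fixed n (i : 'I_n) t : (t < n)%N -> iter t (@ordS n) i = i -> t = 0%N.
Proof.
move=> tn /(congr1 val); rewrite /= val_iter_ordS => e.
have : (i + t == i + 0 %[mod n])%N by rewrite e addn0 modn_small.
by rewrite eqn_modDl mod0n modn_small // => /eqP.
Qed.

Lemma iter_ord_predK n (i : 'I_n) t : iter t (@ordS n) (iter t (@ord_pred n) i) = i.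
Proof. by elim: t i => // t IHt i; rewrite iterSr iterS ord_predK IHt. Qed.

Lemma iter_ordSK n (i : 'I_n) t : iter t (@ord_pred n) (iter t (@ordS n) i) = i.
Proof. by elim: t i => // t IHt i; rewrite iterSr iterS ordSK IHt. Qed.

Lemma iter_ord_pred_surj n (i j : 'I_n) :
  exists2 t, (t < n)%N & j = iter t (@ord_pred n) i.
Proof.
have [t tn ->] := iter_ordS_surj j i.
by exists t; rewrite ?iter_ordSK.
Qed.

Lemma iter_ord_pred_fixed n (i : 'I_n) t :
  (t < n)%N -> iter t (@ord_pred n) i = i -> t = 0%N.
Proof.
move=> tn e; apply: (iter_ordS_fixed (i := i) tn).
by rewrite -{1}e iter_ord_predK.
Qed.

Section Fan.
Variable X : toric_surface.
Notation v := (ray X).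
Notation S := (@ordS (nrays X)).
Notation P := (@ord_pred (nrays X)).

(** A ray inside a cone would meet it in a set which is not a face: a face
    containing an interior point is the whole cone. *)
Lemma no_ray_inside_cone i j : ~ (0 < det2 (v i) (v j) /\ 0 < det2 (v j) (v (S i))).
Proof.
move=> [ij ji].
have [m [m_ge0 facE]] := fan_faces i j.
have D_gt0 := ray_det i; set D := det2 (v i) (v (S i)) in D_gt0.
have D_neq0 : D%:~R != 0 :> rat by rewrite intr_eq0 gt_eqF.
pose a : rat := (det2 (v j) (v (S i)))%:~R / D%:~R.
pose b : rat := (det2 (v i) (v j))%:~R / D%:~R.
have a_gt0 : 0 < a by rewrite divr_gt0 // ltr0z.
have b_gt0 : 0 < b by rewrite divr_gt0 // ltr0z.
have vjE : toQ (v j) = a *: toQ (v i) + b *: toQ (v (S i)).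
  apply: row2_eq; rewrite !mxE /a /b.
    apply: (mulIf D_neq0); rewrite mulrDl.
    rewrite [X in X + _]mulrAC [X in _ + X]mulrAC !divfK //.
    by rewrite -!intrM -intrD; congr _%:~R; rewrite /D /det2; ring.
  apply: (mulIf D_neq0); rewrite mulrDl.
  rewrite [X in X + _]mulrAC [X in _ + X]mulrAC !divfK //.
  by rewrite -!intrM -intrD; congr _%:~R; rewrite /D /det2; ring.
have cone1 u w : cone u w (toQ u).
  by exists 1, 0; rewrite ler01 lexx scale1r scale0r addr0.
have cone2 u w : cone u w (toQ w).
  by exists 0, 1; rewrite ler01 lexx scale1r scale0r add0r.
have conej : cone (v i) (v (S i)) (toQ (v j)).
  by exists a, b; rewrite !ltW.
have pairD (x y : 'rV[rat]_2) : pairing m (x + y) = pairing m x + pairing m y.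
  by rewrite !pairingE !mxE; ring.
have pairZ (c : rat) x : pairing m (c *: x) = c * pairing m x.
  by rewrite !pairingE !mxE; ring.
have mi_ge0 := m_ge0 _ (cone1 (v i) (v (S i))).
have mj0 : pairing m (toQ (v j)) = 0.
  have : (cone (v i) (v (S i)) `&` cone (v j) (v (S j)))%classic (toQ (v j)).
    by split; [exact: conej | exact: cone1].
  by rewrite facE => -[].
have mi0 : pairing m (toQ (v i)) = 0.
  have mSi_ge0 := m_ge0 _ (cone2 (v i) (v (S i))).
  move: mj0; rewrite vjE pairD !pairZ => /eqP.
  rewrite paddr_eq0 ?(mulr_ge0 (ltW a_gt0)) ?(mulr_ge0 (ltW b_gt0)) //.
  by rewrite mulf_eq0 gt_eqF //= => /andP[/eqP].
have : (cone (v i) (v (S i)) `&` cone (v j) (v (S j)))%classic (toQ (v i)).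
  by rewrite facE; split=> //; exact: cone1.
case=> _ [c [e [c_ge0 e_ge0 viE]]].
have : 0 <= e * (det2 (v j) (v (S j)))%:~R.
  by rewrite mulr_ge0 // ler0z ltW // ray_det.
suff -> : e * (det2 (v j) (v (S j)))%:~R = - (det2 (v i) (v j))%:~R.
  by rewrite oppr_ge0 lerz0 leNgt ij.
have := congr1 (fun x : 'rV_2 => x 0 0) viE.
have := congr1 (fun x : 'rV_2 => x 0 1) viE.
rewrite !mxE /det2 !(intrB, intrM) => -> ->; ring.
Qed.

(** Otherwise the cone between the rays [l] and [ordS l] would contain the [i]-th ray
    in its interior. So walking back from a ray on the left of the [i]-th one stays on
    the left until the [i]-th ray is met. *)
Lemma left_pred i l : 0 < det2 (v i) (v (S l)) -> l = i \/ 0 < det2 (v i) (v l).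
Proof.
move=> iSl; have lSl := ray_det l.
case: (ltrgtP (det2 (v i) (v l)) 0) => [il|il|il]; last 2 first.
- by right.
- left; case: (primitive_collinear (ray_primitive i) (ray_primitive l) il) => e.
    by apply: (@ray_inj X).
  by move: lSl; rewrite e (_ : det2 _ _ = - det2 (v i) (v (S l))) ?oppr_gt0 ?ltNge
     ?(ltW iSl) // /det2 !mxE; ring.
case: (@no_ray_inside_cone l i); split=> //.
by rewrite det2C oppr_gt0.
Qed.

Lemma right_succ i l : 0 < det2 (v (P l)) (v i) -> l = i \/ 0 < det2 (v l) (v i).
Proof.
move=> Pli; have := ray_det (P l); rewrite ord_predK => Pll.
case: (ltrgtP (det2 (v l) (v i)) 0) => [li|li|li]; last 2 first.
- by right.
- left; case: (primitive_collinear (ray_primitive l) (ray_primitive i) li) => e.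
    by symmetry; apply: (@ray_inj X).
  by move: Pli; rewrite e (_ : det2 _ _ = - det2 (v (P l)) (v l)) ?oppr_gt0 ?ltNge
     ?(ltW Pll) // /det2 !mxE; ring.
case: (@no_ray_inside_cone (P l) i); rewrite ord_predK; split=> //.
by rewrite det2C oppr_gt0.
Qed.

Lemma nrays_gt0 : (0 < nrays X)%N.
Proof. by have [[i ilt] _] := @fan_complete X 0; case: (nrays X) ilt. Qed.

Lemma ordS_neq i : S i != i.
Proof.
by apply/eqP => e; have := ray_det i; rewrite e det2vv ltxx.
Qed.

Lemma ordS_neq_ord_pred i : S i != P i.
Proof.
apply/eqP => e; have := ray_det i; have := ray_det (P i).
by rewrite ord_predK => Pi; rewrite e det2C oppr_gt0 ltNge ltW.
Qed.

(** As the cones cover the plane, the functional is nonnegative on all the plane, in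
    particular on opposite vectors. *)
Lemma pairing_ge0_eq0 m : (forall i, 0 <= pairing m (v i)) -> m = 0.
Proof.
move=> m_ge0.
pose mQ : 'cV[rat]_2 := map_mx intr m.
have mQ_ge0 x : 0 <= pairing mQ x.
  have [i [a [b [a_ge0 b_ge0 ->]]]] := @fan_complete X x.
  have mQE u : pairing mQ (toQ u) = (pairing m u)%:~R.
    by rewrite !pairingE !mxE intrD !intrM.
  rewrite (_ : pairing _ _ = a * pairing mQ (toQ (v i))
                             + b * pairing mQ (toQ (v (S i)))).
    by rewrite !mQE addr_ge0 // mulr_ge0 // ler0z.
  by rewrite !pairingE !mxE; ring.
have mj0 j : m j 0 = 0.
  have mE : pairing mQ (delta_mx 0 j) = (m j 0)%:~R.
    rewrite pairingE !mxE; case: (unliftP 0 j) => [j'|] ->.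
      by rewrite (ord1 j') (_ : lift _ _ = 1) ?mul0r ?add0r ?mul1r //; apply/val_inj.
    by rewrite mul0r mul1r addr0.
  have mNE : pairing mQ (- delta_mx 0 j) = - (m j 0)%:~R.
    by rewrite -mE !pairingE !mxE; ring.
  have := mQ_ge0 (delta_mx 0 j); have := mQ_ge0 (- delta_mx 0 j).
  rewrite mE mNE oppr_ge0 lerz0 ler0z => le0 ge0.
  by apply/eqP; rewrite eq_le le0.
by apply/colP => j; rewrite mj0 mxE.
Qed.

Definition anticanonical_nef := forall i,
  det2 (v (P i)) (v (S i)) <= det2 (v (P i)) (v i) + det2 (v i) (v (S i)).

Hypothesis nefK : anticanonical_nef.

(** The supporting half-planes at the two neighbours of a ray force all the
    others: on the left, [pairing m + k] grows at least in proportion to the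
    determinant with the [i]-th ray. *)
Lemma left_bound m k i l : 0 <= k -> pairing m (v i) = - k -> 0 < det2 (v i) (v l) ->
  (pairing m (v (S i)) + k) * det2 (v i) (v l)
    <= (pairing m (v l) + k) * det2 (v i) (v (S i)).
Proof.
move=> k_ge0 mi; have [t tn ->] := iter_ordS_surj i l.
pose w t := v (iter t S i).
pose N := (nrays X).-1.
have nE : nrays X = N.+1 by rewrite /N prednK // nrays_gt0.
apply: (@sturm_comparison (fun t => det2 (v i) (w t))
   (fun t => pairing m (w t) + k) (fun t => det2 (w t) (w t.+1))
   (fun t => det2 (w t) (w t.+2)) N) => //=.
- exact: det2vv.
- by rewrite /w /= mi addNr.
- exact: ray_det.
- by move=> s; apply: ray_det.
- move=> s; apply/eqP; rewrite -subr_eq0; apply/eqP.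
  by rewrite -[RHS](det2_plucker (v i) (w s) (w s.+1) (w s.+2)) /w /=; ring.
- move=> s; rewrite /w.
  have := det2_pairing m (w s) (w s.+1) (w s.+2).
  have := nefK (iter s.+1 S i); rewrite /= ordSK -/(w s) -/(w s.+1) -/(w s.+2).
  move=> nefs pl; rewrite -subr_ge0.
  move: nefs; rewrite -subr_ge0 => /(mulr_ge0 k_ge0)/le_trans; apply.
  rewrite le_eqVlt -subr_eq0 -oppr_eq0; apply/orP; left; apply/eqP.
  by rewrite -[RHS]pl /w /=; ring.
- move=> s sN /left_pred[/iter_ordS_fixed-> |]; [|by rewrite nE ltnW|]; auto.
- by rewrite -ltnS -nE.
Qed.

(** The mirror image of [left_bound]. *)
Lemma right_bound m k i l : 0 <= k -> pairing m (v i) = - k ->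
  0 < det2 (v l) (v i) ->
  (pairing m (v (P i)) + k) * det2 (v l) (v i)
    <= (pairing m (v l) + k) * det2 (v (P i)) (v i).
Proof.
move=> k_ge0 mi; have [t tn ->] := iter_ord_pred_surj i l.
pose w t := v (iter t P i).
pose N := (nrays X).-1.
have nE : nrays X = N.+1 by rewrite /N prednK // nrays_gt0.
have wSS s : w s = v (S (iter s.+1 P i)) by rewrite /= ord_predK.
apply: (@sturm_comparison (fun t => det2 (w t) (v i))
   (fun t => pairing m (w t) + k) (fun t => det2 (w t.+1) (w t))
   (fun t => det2 (w t.+2) (w t)) N) => //=.
- exact: det2vv.
- by rewrite /w /= mi addNr.
- by have := ray_det (P i); rewrite ord_predK.
- by move=> s; rewrite (wSS s); apply: ray_det.
- move=> s; apply/eqP; rewrite -subr_eq0; apply/eqP.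
  by rewrite -[RHS](det2_plucker (v i) (w s) (w s.+1) (w s.+2)) /w /= /det2; ring.
- move=> s; rewrite /w.
  have := det2_pairing m (w s) (w s.+1) (w s.+2).
  have := nefK (iter s.+1 P i); rewrite -wSS -/(w s.+1) -/(w s.+2).
  move=> nefs pl; rewrite -subr_ge0.
  move: nefs; rewrite -subr_ge0 => /(mulr_ge0 k_ge0)/le_trans; apply.
  rewrite le_eqVlt -subr_eq0; apply/orP; left; apply/eqP.
  by rewrite -[RHS]pl /w /= /det2; ring.
- move=> s sN /right_succ[/iter_ord_pred_fixed-> |]; [|by rewrite nE ltnW|]; auto.
- by rewrite -ltnS -nE.
Qed.

End Fan.

(** * Lattice points of the multiples of the anticanonical polygon *)

Section Polygon.
Variable X : toric_surface.
Notation v := (ray X).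
Notation S := (@ordS (nrays X)).
Notation P := (@ord_pred (nrays X)).
Hypothesis nefK : anticanonical_nef X.

Definition in_polygon (k : int) (m : 'cV[int]_2) :=
  forall i, 0 <= pairing m (v i) + k.

(** The edge dual to the [i]-th ray, deprived of its end point dual to the cone
    that follows this ray, so that the edges partition the boundary. *)
Definition on_edge (k : int) (i : 'I_(nrays X)) (m : 'cV[int]_2) :=
  [/\ pairing m (v i) = - k, 0 < pairing m (v (S i)) + k
    & 0 <= pairing m (v (P i)) + k].

Lemma pairingN (m : 'cV[int]_2) x : pairing m (- x) = - pairing m x.
Proof. by rewrite !pairingE !mxE; ring. Qed.

Lemma pairingNl (m : 'cV[int]_2) x : pairing (- m) x = - pairing m x.
Proof. by rewrite !pairingE !mxE; ring. Qed.

Lemma on_edge_in_polygon k i m : 0 <= k -> on_edge k i m -> in_polygon k m.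
Proof.
move=> k_ge0 [mi mSi mPi] j.
have Si_gt0 := ray_det i.
have Pi_gt0 := ray_det (P i); rewrite ord_predK in Pi_gt0.
case: (ltrgtP 0 (det2 (v i) (v j))) => ij.
- rewrite -(pmulr_lge0 _ Si_gt0); apply: le_trans (left_bound nefK k_ge0 mi ij).
  by rewrite mulr_ge0 ?ltW.
- rewrite det2C oppr_lt0 in ij.
  rewrite -(pmulr_lge0 _ Pi_gt0); apply: le_trans (right_bound nefK k_ge0 mi ij).
  by rewrite mulr_ge0 // ltW.
- case: (primitive_collinear (ray_primitive i) (ray_primitive j) (esym ij)) => ->.
    by rewrite mi addNr.
  by rewrite pairingN mi opprK addr_ge0.
Qed.

Lemma on_edge_unique k i j m : 0 < k -> on_edge k i m -> on_edge k j m -> i = j.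
Proof.
move=> k_gt0 [mi mSi mPi] [mj mSj mPj].
have strict i' j' : pairing m (v i') = - k -> 0 < pairing m (v (S i')) + k ->
    pairing m (v j') = - k -> ~~ (0 < det2 (v i') (v j')).
  move=> mi' mSi' mj'; apply/negP => ij.
  have := left_bound nefK (ltW k_gt0) mi' ij.
  by rewrite mj' addNr mul0r leNgt mulr_gt0.
have := strict _ _ mi mSi mj; have := strict _ _ mj mSj mi.
rewrite det2C oppr_gt0 -!leNgt => ij_ge0 ij_le0.
have ij0 : det2 (v i) (v j) = 0 by apply/eqP; rewrite eq_le ij_ge0 ij_le0.
case: (primitive_collinear (ray_primitive i) (ray_primitive j) ij0) => e.
  by symmetry; apply: (@ray_inj X).
by move: mj; rewrite e pairingN mi; lia.
Qed.

(** Going around the fan from a ray where the constraint is attained, one must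
    come to a ray where it is not: a functional cannot be negative on all the rays. *)
Lemma boundary_on_edge k j m : 0 < k -> in_polygon k m -> pairing m (v j) = - k ->
  exists i, on_edge k i m.
Proof.
move=> k_gt0 m_in mj; apply: contrapT => no_edge.
have step i : pairing m (v i) = - k -> pairing m (v (S i)) = - k.
  move=> mi; apply: contrapT => mSi; apply: no_edge; exists i; split=> //.
  by rewrite lt_neqAle m_in andbT eq_sym addr_eq0; apply/eqP.
have all_k i : pairing m (v i) = - k.
  have [t _ ->] := iter_ordS_surj j i.
  by elim: t => // t IHt; apply: step.
have : - m = 0.
  apply: (@pairing_ge0_eq0 X) => i.
  by rewrite pairingNl all_k opprK ltW.
move/eqP; rewrite oppr_eq0 => /eqP m0.
by have := all_k j; rewrite m0 pairingE !mxE !mulr0 addr0; lia.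
Qed.

(** On the line carrying an edge, [pairing m (transverse i)] is an affine lattice
    coordinate; [edge_start] and [edge_end] are the integral parts of its values at
    the vertices, which are given by the cones after and before the ray. *)
Definition transverse i := complement (v i).

Definition next_coord i := det2 (v (S i)) (transverse i).
Definition prev_coord i := det2 (v (P i)) (transverse i).

Lemma transverse_det i : det2 (v i) (transverse i) = 1.
Proof. exact/det2_complement/ray_primitive. Qed.

Definition edge_start (k : int) i :=
  (k * (next_coord i - 1) %/ det2 (v i) (v (S i)))%Z.
Definition edge_end (k : int) i :=
  (k * (1 - prev_coord i) %/ det2 (v (P i)) (v i))%Z.

Lemma ord_pred_det i : 0 < det2 (v (P i)) (v i).
Proof. by have := ray_det (P i); rewrite ord_predK. Qed.

Lemma on_edge_dual_point k i t :
  on_edge k i (dual_point (v i) (transverse i) (- k) t)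
  <-> edge_start k i < t <= edge_end k i.
Proof.
have D_gt0 := ray_det i; have D'_gt0 := ord_pred_det i.
rewrite /on_edge /edge_start /edge_end ltz_divLR // lez_divRL //.
rewrite !(pairing_dual_point _ _ (transverse_det i)) transverse_det det2vv.
rewrite -/(next_coord i) -/(prev_coord i) (det2C (v i) (v (P i))).
move: (det2 _ _) (det2 _ _) (next_coord i) (prev_coord i) => D D' p q.
split=> [[_ lo hi]|/andP[lo hi]]; last split; first (apply/andP; split).
all: lia.
Qed.

Lemma edge_lengths_det i :
  det2 (v (P i)) (v (S i)) = next_coord i * det2 (v (P i)) (v i)
                             + prev_coord i * det2 (v i) (v (S i)).
Proof.
have := det2_plucker (v (P i)) (v (S i)) (v i) (transverse i).
rewrite transverse_det -/(next_coord i) -/(prev_coord i) (det2C (v (S i)) (v i)).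
by lia.
Qed.

Lemma edge_start_le_end k i : 0 <= k -> edge_start k i <= edge_end k i.
Proof.
move=> k_ge0; have D_gt0 := ray_det i; have D'_gt0 := ord_pred_det i.
rewrite /edge_end lez_divRL // -(ler_pM2r D_gt0).
have /(ler_wpM2r (ltW D'_gt0)) : edge_start k i * det2 (v i) (v (S i))
    <= k * (next_coord i - 1) by rewrite -lez_divRL.
rewrite mulrAC => /le_trans; apply; rewrite -!mulrA ler_wpM2l //.
by have := nefK i; rewrite edge_lengths_det; lia.
Qed.

Definition edge_points (k : int) i : seq 'cV[int]_2 :=
  [seq dual_point (v i) (transverse i) (- k) (edge_start k i + 1 + t%:Z)
     | t <- iota 0 `|(edge_end k i - edge_start k i)%R|%N].

Lemma mem_edge_points k i m : 0 <= k -> (on_edge k i m <-> m \in edge_points k i).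
Proof.
move=> k_ge0; have le := edge_start_le_end i k_ge0.
split=> [|/mapP[t + ->]]; last first.
  by rewrite mem_iota /= add0n => tlt; apply/on_edge_dual_point; lia.
move=> on_m; have [mi _ _] := on_m; move: on_m.
rewrite -(dual_point_pairing m (transverse_det i)) mi => /on_edge_dual_point bounds.
apply/mapP; exists `|(pairing m (transverse i) - (edge_start k i + 1))%R|%N.
  by rewrite mem_iota; lia.
by congr dual_point; lia.
Qed.

Lemma edge_points_uniq k i : uniq (edge_points k i).
Proof.
rewrite map_inj_uniq ?iota_uniq // => s t /(congr1 (fun m => pairing m (transverse i))).
by rewrite !(pairing_dual_point _ _ (transverse_det i)) transverse_det; lia.
Qed.

Fixpoint polygon_points (k : nat) : seq 'cV[int]_2 :=
  if k is k'.+1 then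
    polygon_points k' ++ [seq m | i <- enum 'I_(nrays X), m <- edge_points k%:Z i]
  else [:: 0].

Lemma mem_polygon_points k m : in_polygon k%:Z m <-> m \in polygon_points k.
Proof.
elim: k => [|k IHk] /=.
  rewrite inE; split=> [m_in|/eqP-> i].
    by apply/eqP/(@pairing_ge0_eq0 X) => i; rewrite -[pairing _ _]addr0 m_in.
  by rewrite pairingE !mxE !mulr0 !addr0.
rewrite mem_cat; split=> [m_in|/orP[/IHk m_in|/allpairsPdep[i [x [_ xi ->]]]]].
- case: (boolP (m \in polygon_points k)) => //= m_notin.
  have [i mi] : exists i, pairing m (v i) = - k.+1%:Z.
    apply: contrapT => no_i; case/negP: m_notin; apply/IHk => i.
    have : pairing m (v i) <> - k.+1%:Z by move=> e; apply: no_i; exists i.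
    by have := m_in i; lia.
  have [j m_j] := boundary_on_edge (isT : 0 < k.+1%:Z) m_in mi.
  apply/allpairsPdep; exists j, m; split; rewrite ?mem_enum //.
  exact/mem_edge_points.
- by move=> i; have := m_in i; lia.
by move/(mem_edge_points i x (isT : 0 <= k.+1%:Z)): xi; apply: on_edge_in_polygon.
Qed.

Lemma polygon_points_uniq k : uniq (polygon_points k).
Proof.
elim: k => //= k IHk; rewrite cat_uniq IHk /=; apply/andP; split.
  apply/hasPn => m /allpairsPdep[i [x [_ xi ->]]].
  have [mi _ _] := (mem_edge_points i x (isT : 0 <= k.+1%:Z)).2 xi.
  by apply/negP => /mem_polygon_points/(_ i); rewrite mi; lia.
apply: allpairs_uniq_dep (enum_uniq _) _ _ => /= [i _|].
  exact: edge_points_uniq.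
move=> _ _ /allpairsPdep[i [m [_ + ->]]] /allpairsPdep[j [m' [_ + ->]]] /=.
move=> mi mj e; move: mi mj; rewrite -e.
move=> /(mem_edge_points i m (isT : 0 <= k.+1%:Z)) mi.
move=> /(mem_edge_points j m (isT : 0 <= k.+1%:Z)) mj.
by rewrite (on_edge_unique _ mi mj).
Qed.

Lemma size_polygon_points k : size (polygon_points k)
  = (1 + \sum_(j < k) \sum_i `|(edge_end j.+1 i - edge_start j.+1 i)%R|)%N.
Proof.
elim: k => [|k IHk]; first by rewrite big_ord0.
rewrite big_ord_recr /= size_cat IHk addnA; congr addn.
rewrite size_allpairs_dep sumnE big_map -[RHS]big_enum /=.
by apply: eq_bigr => i _; rewrite size_map size_iota.
Qed.

Lemma h0_anticanonical k : h0 (- canonical_divisor X *+ k) = size (polygon_points k).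
Proof.
rewrite /h0 (_ : [set m | _]%classic = [set` polygon_points k]%classic).
  rewrite -[polygon_points k in RHS]undup_id ?polygon_points_uniq // -card_fseq.
  have fin := finite_seq (polygon_points k).
  congr #|` _|; apply/fsetP => m; rewrite in_fset_set // in_fset /=.
  by apply/idP/idP; rewrite in_setE.
apply/seteqP; split=> m /=.
  move=> m_in; apply/mem_polygon_points => i; have := m_in i.
  by rewrite ffunMnE !ffunE opprK natz.
move/mem_polygon_points => m_in i; have := m_in i.
by rewrite ffunMnE !ffunE opprK natz.
Qed.

End Polygon.

(** * Counting lattice points by local contributions of the cones *)

(** The fractional part of [x / d]. *)
Definition fpart (x d : int) : rat := (x %% d)%Z%:~R / d%:~R.

Lemma floorE x d : 0 < d -> ((x %/ d)%Z)%:~R = x%:~R / d%:~R - fpart x d.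
Proof.
move=> d_gt0; have d_neq0 : d%:~R != 0 :> rat by rewrite intr_eq0 gt_eqF.
apply: (mulIf d_neq0); rewrite mulrBl /fpart !divfK //.
by rewrite -intrM -intrB {2}(divz_eq x d) addrK.
Qed.

Section LocalContributions.
Variable X : toric_surface.
Notation v := (ray X).
Notation S := (@ordS (nrays X)).
Notation P := (@ord_pred (nrays X)).

(** The two edges of the [k]-th multiple of the polygon at the vertex dual to the cone
    have lattice coordinates; this is the difference of the fractional parts of the
    coordinates of the vertex on the edge before and on the edge after it. *)
Definition cone_contribution (k : int) i : rat :=
  fpart (k * (next_coord i - 1)) (det2 (v i) (v (S i)))
  - fpart (k * (1 - prev_coord (S i))) (det2 (v i) (v (S i))).

Lemma ray_det_neq0 i : (det2 (v i) (v (S i)))%:~R != 0 :> rat.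
Proof. by rewrite intr_eq0 gt_eqF // ray_det. Qed.

Lemma ord_pred_det_neq0 i : (det2 (v (P i)) (v i))%:~R != 0 :> rat.
Proof. by rewrite intr_eq0 gt_eqF // ord_pred_det. Qed.

Definition edge_length i : rat :=
  (1 - prev_coord i)%:~R / (det2 (v (P i)) (v i))%:~R
  - (next_coord i - 1)%:~R / (det2 (v i) (v (S i)))%:~R.

(** The degree of [- K_X] on the [i]-th prime divisor is the lattice length of the
    [i]-th edge. *)
Lemma anticanonical_degree i :
  \sum_a prime_intersection a i = edge_length i.
Proof.
have SnP := ordS_neq_ord_pred i; have Sn := ordS_neq i.
have Pn : P i != i by rewrite -{2}[i]ord_predK eq_sym ordS_neq.
rewrite (bigD1 i) //= (bigD1 (P i)) //= (bigD1 (S i)) /=; last by rewrite SnP Sn.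
rewrite big1 => [|a /andP[/andP[ai aP] aS]]; last first.
  rewrite /prime_intersection eq_sym (negPf ai) (negPf aS).
  by rewrite -{1}[i]ord_predK (inj_eq (@ordS_inj _)) eq_sym (negPf aP).
rewrite /prime_intersection eqxx [i == P i]eq_sym (negPf Pn) ord_predK eqxx.
rewrite [i == S i]eq_sym (negPf Sn) eqxx.
have -> : (i == S (S i)) = false.
  by rewrite -{1}[i]ord_predK (inj_eq (@ordS_inj _)) eq_sym (negPf SnP).
rewrite edge_lengths_det /edge_length.
have := ray_det_neq0 i; have := ord_pred_det_neq0 i.
move: (det2 (v i) _) (det2 _ (v i)) => D D' D'0 D0.
by rewrite !(intrB, intrD, intrM); field; rewrite D0.
Qed.

Lemma nef_anticanonical : nef (- canonical_divisor X) -> anticanonical_nef X.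
Proof.
move=> nefK i; have := nefK i.
have -> : intersection (- canonical_divisor X) (prime_divisor i) = edge_length i.
  rewrite -anticanonical_degree /intersection; apply: eq_bigr => a _.
  rewrite (bigD1 i) //= big1 => [|b bi]; rewrite !ffunE ?(negPf bi) ?mulr0 ?mul0r //.
  by rewrite eqxx opprK !mul1r addr0.
rewrite edge_lengths_det.
have D_gt0 := ray_det i; have D'_gt0 := ord_pred_det i.
have D0 := ray_det_neq0 i; have D'0 := ord_pred_det_neq0 i.
rewrite -(ltr0z rat) in D_gt0; rewrite -(ltr0z rat) in D'_gt0.
rewrite -(pmulr_rge0 _ (mulr_gt0 D_gt0 D'_gt0)).
have -> : (det2 (v i) (v (S i)))%:~R * (det2 (v (P i)) (v i))%:~R * edge_length i
    = ((1 - prev_coord i) * det2 (v i) (v (S i))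
       - (next_coord i - 1) * det2 (v (P i)) (v i))%:~R :> rat.
  rewrite /edge_length; move: D0 D'0; clear.
  move: (det2 (v i) _) (det2 _ (v i)) => D D' D0 D'0.
  by rewrite !(intrB, intrM); field; rewrite D0.
by rewrite ler0z; lia.
Qed.

Lemma intersection_KK : let K := canonical_divisor X in
  intersection K K = \sum_i edge_length i.
Proof.
rewrite /intersection exchange_big; apply: eq_bigr => i _.
rewrite -anticanonical_degree; apply: eq_bigr => j _.
by rewrite !ffunE mulrNN !mul1r.
Qed.

(** The end points of the edges are the vertices of the polygon. Grouping by
    vertices the errors made in replacing the number of points of a half-open edge
    by its length gives one error term for each cone. *)
Lemma card_boundary k : 
  \sum_(i < nrays X) ((edge_end k i)%:~R - (edge_start k i)%:~R)
  = k%:~R * (\sum_i edge_length i) + \sum_i cone_contribution k i.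
Proof.
transitivity (\sum_(i < nrays X) (k%:~R * edge_length i
    + (fpart (k * (next_coord i - 1)) (det2 (v i) (v (S i)))
       - fpart (k * (1 - prev_coord i)) (det2 (v (P i)) (v i))))).
  apply: eq_bigr => i _.
  rewrite /edge_end /edge_start !floorE ?ray_det ?ord_pred_det //.
  by rewrite /edge_length !intrM; ring.
rewrite big_split -mulr_sumr; congr (_ + _).
rewrite sumrB /cone_contribution sumrB; congr (_ - _).
rewrite (reindex_inj (@ordS_inj _)); apply: eq_bigr => i _.
by rewrite ordSK.
Qed.

Lemma h0_cone_contributions k : anticanonical_nef X ->
  let K := canonical_divisor X in
  (h0 (- K *+ k))%:R = 1 + intersection K K * (\sum_(j < k) j.+1%:R)
     + \sum_i \sum_(j < k) cone_contribution j.+1 i :> rat.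
Proof.
move=> nefK /=; rewrite h0_anticanonical // size_polygon_points.
rewrite intersection_KK [X in _ = _ + X]exchange_big natrD -addrA; congr (_ + _).
rewrite natr_sum mulr_sumr -big_split; apply: eq_bigr => j _.
rewrite mulrC; apply: etrans (card_boundary j.+1).
rewrite natr_sum; apply: eq_bigr => i _.
by rewrite -intrB natr_absz ger0_norm // subr_ge0 edge_start_le_end.
Qed.

End LocalContributions.

(** * Dedekind sums *)

Section RootsOfUnity.
Variables (R : nat).

Lemma exprz_modz (e : algC) (x : int) : (0 < R)%N -> e ^+ R = 1 ->
  e ^ x = e ^ (x %% R)%Z.
Proof.
move=> R_gt0 eR; have eU : e \is a GRing.unit.
  by rewrite -(unitrX_pos _ R_gt0) eR unitr1.
rewrite {1}(divz_eq x R) exprzDr // [(x %/ R)%Z * _]mulrC -exprz_exp.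
by rewrite -exprnP eR exp1rz mul1r.
Qed.

Variable z : algC.
Hypothesis zP : R.-primitive_root z.

Let R_gt0 : (0 < R)%N. Proof. exact: prim_order_gt0 zP. Qed.

Let zX1 i : (z ^+ i) ^+ R = 1.
Proof. by rewrite exprAC (prim_expr_order zP) expr1n. Qed.

Lemma nontrivial_root i : (0 < i < R)%N -> 1 - z ^+ i != 0.
Proof.
move=> /andP[i_gt0 iR]; rewrite subr_eq0 eq_sym -(prim_order_dvd zP).
by rewrite gtnNdvd.
Qed.

Lemma prim_root_exprz b : coprimez R%:Z b -> R.-primitive_root (z ^ b).
Proof.
move=> co; rewrite (exprz_modz _ R_gt0 (prim_expr_order zP)).
have mod_ge0 : 0 <= (b %% R)%Z by rewrite modz_ge0; lia.
rewrite -(gez0_abs mod_ge0) [_ ^ _]/(_ ^+ _) prim_root_exp_coprime //.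
by rewrite coprime_sym; move: co; rewrite /coprimez -gcdz_modr.
Qed.

Lemma sum_nontrivial_roots n : (0 < n < R)%N ->
  \sum_(1 <= i < R) (z ^+ i) ^+ n = -1.
Proof.
move=> nR; have := subrX1 (z ^+ n) R.
rewrite zX1 subrr => /esym/eqP; rewrite mulf_eq0 -oppr_eq0 opprB.
rewrite (negPf (nontrivial_root nR)) /= -(big_mkord xpredT) big_ltn // expr0 addrC.
rewrite addr_eq0 => /eqP <-.
by apply: eq_bigr => i _; rewrite exprAC.
Qed.

(** The summands for [x + 1] and for [x] differ by [e ^ (1 + x)], where [e] is the
    root of unity, and these powers add up to [-1] unless [1 + x] is a multiple of [R].
    So the sum is the fractional part of [x / R] up to a constant, which comes from
    exchanging [e] and [e^-1] in the sum for [x = 0]. The value does not depend on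
    [z]: this is what allows replacing the roots [e] by their powers [e ^ b] below. *)
Lemma sawtooth_sum x :
  R%:R^-1 * (\sum_(1 <= i < R) (z ^+ i) ^ (1 + x) / (1 - z ^+ i))
  = ratr (fpart x R) - (R%:R - 1) / (2 * R%:R).
Proof.
have R_neq0 : R%:R != 0 :> algC by rewrite pnatr_eq0 -lt0n.
have sum0 : 2 * (\sum_(1 <= i < R) z ^+ i / (1 - z ^+ i)) = 1 - R%:R.
  rewrite mulr_natl mulr2n {2}big_nat_rev /= -big_split /=.
  rewrite (eq_big_nat _ _ (F2 := fun=> -1)) => [|i iR].
    by rewrite sumr_const_nat mulNrn natrB // opprB.
  have e_neq1 := nontrivial_root iR.
  have zi0 : z ^+ i != 0 by rewrite -unitfE -(unitrX_pos _ R_gt0) zX1 unitr1.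
  have ie : z ^+ (1 + R - i.+1) = (z ^+ i)^-1.
    apply: (mulIf zi0); rewrite mulVf // -exprD -(prim_expr_order zP).
    by congr (_ ^+ _); lia.
  rewrite ie; move: (z ^+ i) e_neq1 zi0 => e e_neq1 e0.
  field; rewrite e_neq1 e0 /= andbT; move: e_neq1.
  by rewrite !subr_eq0 eq_sym.
have sumn n : (n < R)%N ->
    \sum_(1 <= i < R) (z ^+ i) ^+ n.+1 / (1 - z ^+ i)
    = n%:R - (R%:R - 1) / 2.
  elim: n => [_|n IHn nR].
    apply: (mulfI (_ : 2 != 0)); first by rewrite pnatr_eq0.
    rewrite sub0r mulrN [RHS](_ : _ = 1 - R%:R); first by rewrite -sum0.
    by field.
  have one : 1 = - \sum_(1 <= i < R) (z ^+ i) ^+ n.+1.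
    by rewrite sum_nontrivial_roots // opprK.
  rewrite -natr1 addrAC -(IHn (ltnW nR)) [X in _ = _ + X]one -sumrB.
  apply: eq_big_nat => i iR.
  by have e_neq1 := nontrivial_root iR; rewrite [_ ^+ n.+2]exprS; field.
have mod_ge0 : 0 <= (x %% R)%Z by rewrite modz_ge0; lia.
have mod_lt : (`|(x %% R)%Z|%N < R)%N by have := ltz_pmod x (_ : 0 < R%:Z); lia.
rewrite (eq_bigr (fun i => (z ^+ i) ^+ `|(x %% R)%Z|.+1 / (1 - z ^+ i))) => [|i _].
  rewrite sumn // /fpart fmorph_div !rmorph_int natr_absz ger0_norm //.
  by field.
congr (_ / _); rewrite (exprz_modz _ R_gt0 (zX1 i)) -modzDmr.
rewrite -(exprz_modz _ R_gt0 (zX1 i)) -(gez0_abs mod_ge0).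
by rewrite -[1 + _]/(Posz (1 + _)) add1n.
Qed.

End RootsOfUnity.

Section DedekindSum.
Variables (R : nat) (b b' : int).
Hypotheses (R_gt0 : (0 < R)%N) (b_inv : (b * b' = 1 %[mod R])%Z).
Notation s := (QuotientSingularity R 1 b).

Let bb'1 : (R %| b * b' - 1)%Z.
Proof. by rewrite -eqz_mod_dvd; apply/eqP. Qed.

Let co_b : coprimez R%:Z b.
Proof.
have /dvdzP[q qR] := bb'1.
by apply/coprimezP; exists (- q, b') => /=; lia.
Qed.

Section Root.
Variable z : algC.
Hypothesis zP : R.-primitive_root z.

Lemma root_exprzC i : (z ^+ i) ^ b = (z ^ b) ^+ i.
Proof. by rewrite !exprnP exprzAC. Qed.

Let zX1 i : (z ^+ i) ^+ R = 1.
Proof. by rewrite exprAC (prim_expr_order zP) expr1n. Qed.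

Lemma root_neq0 i : z ^+ i != 0.
Proof. by rewrite -unitfE -(unitrX_pos _ R_gt0) zX1 unitr1. Qed.

Lemma dedekind_sum_roots m :
  dedekind_sum s m = R%:R^-1 * \sum_(1 <= i < R)
    ((z ^+ i) ^ m / ((1 - z ^+ i) * (1 - (z ^+ i) ^ b))).
Proof.
rewrite /dedekind_sum /=; congr (_ * _).
have zb := prim_root_exprz zP co_b.
have roots_uniq : uniq [seq z ^+ i | i <- index_iota 1 R].
  rewrite map_inj_in_uniq ?iota_uniq // => i j.
  rewrite !mem_index_iota => iR jR /eqP.
  by rewrite (eq_prim_root_expr zP) !modn_small => [/eqP|//|//]; lia.
rewrite (_ : [set e | _]%classic = [set` [seq z ^+ i | i <- index_iota 1 R]]%classic).
  by rewrite -fsbig_seq // big_map; apply: eq_bigr => i _; rewrite expr1z.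
apply/seteqP; split=> [e [eR]|_ /= /mapP[i + ->]]; rewrite expr1z.
  move=> /= e1 _; have [[i iR] /= eE] := prim_rootP zP eR.
  apply/mapP; exists i => //; rewrite mem_index_iota iR andbT lt0n.
  by apply: contraNneq e1 => i0; rewrite eE i0.
rewrite mem_index_iota => iR; split=> //; rewrite eq_sym -subr_eq0.
  exact: nontrivial_root zP _ iR.
by rewrite root_exprzC; exact: nontrivial_root zb _ iR.
Qed.

Lemma exprz_inverse i m : ((z ^+ i) ^ b) ^ (b' * m) = (z ^+ i) ^ m.
Proof.
rewrite exprz_exp mulrA; have /dvdzP[q /eqP] := bb'1.
rewrite subr_eq => /eqP->; rewrite mulrDl mul1r -mulrA mulrCA.
by rewrite exprzDr ?unitfE ?root_neq0 // -exprz_exp -exprnP zX1 exp1rz mul1r.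
Qed.

End Root.

(** Splitting [1 - e * e ^ b] as [(1 - e) + e * (1 - e ^ b)] cancels one factor of
    the denominator in each term of the difference, which leaves two sawtooth sums,
    over the roots [e] and over the roots [e ^ - b]. *)
Lemma dedekind_sum_step m :
  dedekind_sum s (m + (1 + b)) - dedekind_sum s m
  = ratr (fpart (- (b' * m)) R - fpart m R).
Proof.
have [z zP] := C_prim_root_exists R_gt0.
have co_Nb : coprimez R%:Z (- b) by rewrite coprimezN.
have zNb := prim_root_exprz zP co_Nb; have zb := prim_root_exprz zP co_b.
rewrite !(dedekind_sum_roots zP) -mulrBr -sumrB rmorphB /=.
set k := (R%:R - 1) / (2 * R%:R) : algC.
rewrite -[RHS](addrKA (- k)) [- k + _]addrC -(sawtooth_sum zP m)
  -(sawtooth_sum zNb (- (b' * m))).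
rewrite -mulrBr -sumrB; congr (_ * _); apply: eq_big_nat => i iR.
have eU : z ^+ i \is a GRing.unit by rewrite unitfE (root_neq0 zP).
have e_neq1 := nontrivial_root zP iR; have eb_neq1 := nontrivial_root zb iR.
have Nb : (z ^ (- b)) ^+ i = ((z ^+ i) ^ b)^-1.
  by rewrite exprnP exprzAC -exprnP invr_expz.
rewrite -(root_exprzC z) in eb_neq1; rewrite Nb.
have expz : ((z ^+ i) ^ b)^-1 ^ (1 + - (b' * m)) = ((z ^+ i) ^ b)^-1 * (z ^+ i) ^ m.
  rewrite exprzDr ?unitrV ?unitrXz // expr1z; congr (_ * _).
  by rewrite exprz_inv opprK (exprz_inverse zP).
have expD : (z ^+ i) ^ (m + (1 + b)) = (z ^+ i) ^ m * (z ^+ i) * (z ^+ i) ^ b.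
  by rewrite !exprzDr ?expr1z ?mulrA.
have exp1 : (z ^+ i) ^ (1 + m) = (z ^+ i) ^ m * (z ^+ i).
  by rewrite addrC exprzDr ?expr1z.
have eb0 : (z ^+ i) ^ b != 0 by rewrite -unitfE unitrXz.
rewrite expz expD exp1.
move: (z ^+ i) ((z ^+ i) ^ b) ((z ^+ i) ^ m) e_neq1 eb_neq1 eb0 => e eb em.
move=> e_neq1 eb_neq1 eb0.
have eb_neq1' : eb - 1 != 0 by rewrite -opprB oppr_eq0.
by field; rewrite eb0 e_neq1 eb_neq1 eb_neq1'.
Qed.

(** The same with [1 - e * e ^ b] split as [(1 - e ^ b) + e ^ b * (1 - e)]. This form
    matches the cones whose rays correspond to the coordinates in the other order. *)
Lemma dedekind_sum_step' m :
  dedekind_sum s (m + (1 + b)) - dedekind_sum s m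
  = ratr (fpart (- m) R - fpart (b' * m) R).
Proof.
have [z zP] := C_prim_root_exists R_gt0.
have coN1 : coprimez R%:Z (-1) by rewrite coprimezN /coprimez gcdzC gcd1z.
have zN1 := prim_root_exprz zP coN1; have zb := prim_root_exprz zP co_b.
rewrite !(dedekind_sum_roots zP) -mulrBr -sumrB rmorphB /=.
set k := (R%:R - 1) / (2 * R%:R) : algC.
rewrite -[RHS](addrKA (- k)) [- k + _]addrC -(sawtooth_sum zN1 (- m))
  -(sawtooth_sum zb (b' * m)).
rewrite -mulrBr -sumrB; congr (_ * _); apply: eq_big_nat => i iR.
have eU : z ^+ i \is a GRing.unit by rewrite unitfE (root_neq0 zP).
have e_neq1 := nontrivial_root zP iR; have eb_neq1 := nontrivial_root zb iR.
have N1 : (z ^ (-1)) ^+ i = (z ^+ i)^-1.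
  by rewrite exprnP exprzAC -exprnP -invr_expz expr1z.
rewrite -!(root_exprzC z) in eb_neq1 *; rewrite N1.
have expN1 : (z ^+ i)^-1 ^ (1 + - m) = (z ^+ i)^-1 * (z ^+ i) ^ m.
  by rewrite exprzDr ?unitrV // expr1z exprz_inv opprK.
have expD : (z ^+ i) ^ (m + (1 + b)) = (z ^+ i) ^ m * (z ^+ i) * (z ^+ i) ^ b.
  by rewrite !exprzDr ?expr1z ?mulrA.
have expb : ((z ^+ i) ^ b) ^ (1 + b' * m) = (z ^+ i) ^ b * (z ^+ i) ^ m.
  by rewrite exprzDr ?unitrXz // expr1z (exprz_inverse zP).
have e0 : z ^+ i != 0 by rewrite -unitfE.
rewrite expN1 expD expb.
move: (z ^+ i) ((z ^+ i) ^ b) ((z ^+ i) ^ m) e_neq1 eb_neq1 e0 => e eb em.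
move=> e_neq1 eb_neq1 e0.
have e_neq1' : e - 1 != 0 by rewrite -opprB oppr_eq0.
by field; rewrite e0 e_neq1 eb_neq1 e_neq1'.
Qed.

End DedekindSum.

(** * The contribution of a cone and the Dedekind sums of its residue *)

Lemma fpart_eqmod d x y : (d %| x - y)%Z -> fpart x d = fpart y d.
Proof. by rewrite -eqz_mod_dvd /fpart => /eqP->. Qed.

Lemma fpartM w d x : 0 < w -> fpart (w * x) (w * d) = fpart x d.
Proof.
move=> w_gt0; have w_neq0 : w%:~R != 0 :> rat by rewrite intr_eq0 gt_eqF.
rewrite /fpart (_ : (w * x %% (w * d))%Z = w * (x %% d)%Z).
  by rewrite !intrM invfM mulrACA divff // mul1r.
by rewrite /modz divzMpl //; ring.
Qed.

(** The lattice is generated by [v] and the vector [y0] with [r y0 = u + b v], so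
    [det2 v y0] is a unit; both claims follow by taking determinants in this
    relation. *)
Lemma quotient_presentation_weight (r : nat) b u v : (0 < r)%N ->
    quotient_presentation (QuotientSingularity r 1 b) u v ->
  r = `|det2 u v|%N /\
  forall y, det2 v y = 1 -> (r%:Z %| det2 u y + b)%Z.
Proof.
move=> r_gt0 [y0 /= [ry0 gen]]; rewrite scale1r in ry0.
have det_ry0 x : r%:Z * det2 y0 x = det2 u x + b * det2 v x.
  have e0 := congr1 (fun x : 'rV_2 => x 0 0) ry0.
  have e1 := congr1 (fun x : 'rV_2 => x 0 1) ry0.
  rewrite !mxE in e0 e1.
  by rewrite /det2 mulrBr !mulrA e0 e1; ring.
split=> [|y vy]; last first.
  by rewrite -[b]mulr1 -vy -det_ry0 dvdz_mulr.
have [c1 [d1 [f1 e1]]] := gen (delta_mx 0 0).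
have [c2 [d2 [f2 e2]]] := gen (delta_mx 0 1).
have det_comb c d f c' d' f' :
  det2 (c *: u + d *: v + f *: y0) (c' *: u + d' *: v + f' *: y0)
  = (c * d' - c' * d) * det2 u v + (c * f' - c' * f) * det2 u y0
    + (d * f' - d' * f) * det2 v y0.
  by rewrite /det2 !mxE; ring.
have uv := det_ry0 v; rewrite det2vv mulr0 addr0 in uv.
have uy := det_ry0 y0; rewrite det2vv mulr0 in uy.
have unit_vy : ((d1 - c1 * b) * (f2 + c2 * r) - (d2 - c2 * b) * (f1 + c1 * r))
    * det2 v y0 = 1.
  transitivity (det2 (delta_mx 0 0) (delta_mx 0 1)); last by rewrite /det2 !mxE.
  rewrite e1 e2 det_comb -uv (_ : det2 u y0 = - (b * det2 v y0)); last by lia.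
  by rewrite (det2C y0 v); ring.
have := congr1 absz unit_vy; rewrite abszM => /eqP; rewrite muln_eq1 => /andP[_ /eqP].
by rewrite -uv abszM (det2C y0 v) abszN => ->; rewrite muln1.
Qed.

Lemma fpart_rescale w rho l x y z z' : 0 < w -> 0 < rho ->
    (w * l %| x - w * z)%Z -> (rho * l %| y - rho * z')%Z -> (l %| z - z')%Z ->
  fpart x (w * l) = fpart y (rho * l).
Proof.
move=> w_gt0 rho_gt0 /fpart_eqmod-> /fpart_eqmod-> /fpart_eqmod e.
by rewrite !fpartM.
Qed.

(** Only the class modulo [l] of the width matters for the fractional parts, so
    that the width can be replaced by its remainder [rho]: this is why a cone and its
    residue have the same contribution. Here [x] and [y] are the mutually inverse
    coordinates of the two rays, and [b'] is an inverse of the second weight of the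
    residue, congruent to [- y] modulo [l]. *)
Lemma residue_fparts (w rho l x y a k : int) :
    0 < w -> 0 < rho -> (l %| w - rho)%Z ->
    (w * l %| x * y - 1)%Z -> (w * l %| x + w * a - 1)%Z ->
  let b := rho * a - 1 in let b' := - (1 + y * rho * a) in
  let m := k * (rho * a) in
  [/\ (b * b' = 1 %[mod rho * l])%Z,
      fpart (k * (1 - x)) (w * l) = fpart m (rho * l),
      fpart (k * (x - 1)) (w * l) = fpart (- m) (rho * l),
      fpart (k * (y - 1)) (w * l) = fpart (- (b' * m)) (rho * l)
    & fpart (k * (1 - y)) (w * l) = fpart (b' * m) (rho * l)].
Proof.
move=> w_gt0 rho_gt0 /dvdzP[C wE] /dvdzP[A xyE] /dvdzP[B xE] b b' m.
have {}xE : x = 1 - w * a + B * (w * l) by rewrite -xE; ring.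
have {}wE : rho = w - C * l by rewrite -wE; ring.
(* [b * b' - 1] is [- (1 + b * y) * (1 + b)], where [1 + b = rho * a]. *)
have l_by : (l %| 1 + b * y)%Z.
  apply/dvdzP; exists (- A * w + y * B * w - y * C * a).
  transitivity (- (A * (w * l)) + y * B * w * l - y * C * a * l); last by ring.
  by rewrite -xyE xE /b wE; ring.
have next_y : (w * l %| k * (y - 1) - w * (k * y * a))%Z.
  apply/dvdzP; exists (k * (A - y * B)).
  transitivity (k * (A * (w * l)) - k * y * B * (w * l)); last by ring.
  by rewrite -xyE xE; ring.
have next_x : (w * l %| k * (1 - x) - w * (k * a))%Z.
  by apply/dvdzP; exists (- k * B); rewrite xE; ring.
have neg d s t : (d %| s)%Z -> t = - s -> (d %| t)%Z by move=> ds ->; rewrite rpredN.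
have eq0 d s : s = 0 -> (d %| s)%Z by move=> ->; rewrite dvdz0.
split.
- apply/eqP; rewrite eqz_mod_dvd (neg _ ((1 + b * y) * (rho * a))) //.
    by rewrite mulrC dvdz_mul // dvdz_mulr.
  by rewrite /b' /b; ring.
- apply: fpart_rescale next_x (eq0 _ _ _) (eq0 _ _ _) => //; last exact: subrr.
  by rewrite /m; ring.
- apply: (@fpart_rescale _ _ _ _ _ (- (k * a)) (- (k * a))) => //.
  + by apply: neg next_x _; ring.
  + by apply: eq0; rewrite /m; ring.
  + by apply: eq0; rewrite subrr.
- apply: (@fpart_rescale _ _ _ _ _ _ (- (b' * k * a))) next_y _ _ => //.
  + by apply: eq0; rewrite /m; ring.
  + by apply: neg (dvdz_mull (k * a) l_by) _; rewrite /b' /b; ring.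
- apply: (@fpart_rescale _ _ _ _ _ (- (k * y * a)) (b' * k * a)) => //.
  + by apply: neg next_y _; ring.
  + by apply: eq0; rewrite /m; ring.
  + by rewrite (_ : _ - _ = (k * a) * (1 + b * y)) ?dvdz_mull // /b' /b; ring.
Qed.

Section Cone.
Variables (X : toric_surface) (i : 'I_(nrays X)).
Notation u := (ray X i).
Notation v := (ray X (ordS i)).
Notation w := (width u v).
Notation l := (local_index u v).
Notation p := (next_coord i).
Notation q := (prev_coord (ordS i)).

Lemma width_dvd y : (w%:Z %| det2 v y - det2 u y)%Z.
Proof.
have -> : det2 v y - det2 u y = (v - u) 0 0 * y 0 1 - (v - u) 0 1 * y 0 0.
  by rewrite /det2 !mxE; ring.
have w0 : (w%:Z %| (v - u) 0%R 0%R)%Z by rewrite dvdzE dvdn_gcdl.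
have w1 : (w%:Z %| (v - u) 0%R 1%R)%Z by rewrite dvdzE dvdn_gcdr.
by rewrite rpredB // dvdz_mulr.
Qed.

Lemma width_index : w%:Z * l%:Z = det2 u v.
Proof.
have w0 : (w%:Z %| (v - u) 0%R 0%R)%Z by rewrite dvdzE dvdn_gcdl.
have w1 : (w%:Z %| (v - u) 0%R 1%R)%Z by rewrite dvdzE dvdn_gcdr.
have e : w%:Z * pairing (edge_normal u v) u = det2 u v.
  have dx := divzK w0; have dy := divzK w1.
  rewrite pairingE ![edge_normal _ _ _ _]mxE /=.
  rewrite -/(width u v).
  move: ((v - u) 0%R 0%R %/ _)%Z ((v - u) 0%R 1%R %/ _)%Z dx dy => b a.
  rewrite !mxE => dx dy.
  transitivity (u 0 0 * (a * w%:Z) - u 0 1 * (b * w%:Z)); first by ring.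
  by rewrite dx dy /det2; ring.
have := congr1 absz e; rewrite abszM /= -/(local_index u v).
by have := ray_det i; lia.
Qed.

Lemma width_gt0 : 0 < w%:Z :> int.
Proof. by have := ray_det i; rewrite -width_index; case: (width u v). Qed.

Lemma local_index_gt0 : 0 < l%:Z :> int.
Proof. by have := ray_det i; rewrite -width_index (pmulr_rgt0 _ width_gt0). Qed.

Lemma prev_coordE : q = det2 u (transverse (ordS i)).
Proof. by rewrite /prev_coord ordSK. Qed.

Lemma coords_inverse : (w%:Z * l%:Z %| p * q - 1)%Z.
Proof.
have := det2_plucker u v (transverse i) (transverse (ordS i)).
rewrite !transverse_det -prev_coordE -/(next_coord i) -width_index => e.
apply/dvdzP; exists (- det2 (transverse i) (transverse (ordS i))); lia.
Qed.

Lemma width_dvd_next : (w%:Z %| p - 1)%Z.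
Proof. by have := width_dvd (transverse i); rewrite transverse_det. Qed.

Lemma width_dvd_prev : (w%:Z %| 1 - q)%Z.
Proof.
by have := width_dvd (transverse (ordS i)); rewrite transverse_det -prev_coordE.
Qed.

Lemma type_weight r a : has_singularity_type u v r a ->
  (w%:Z * l%:Z %| q + a - 1)%Z \/ (w%:Z * l%:Z %| p + a - 1)%Z.
Proof.
have D_gt0 := ray_det i; case=> r_gt0 _ [] /(quotient_presentation_weight r_gt0).
  case=> rE /(_ _ (transverse_det (ordS i))); rewrite -prev_coordE => r_dvd.
  have -> : w%:Z * l%:Z = r by rewrite width_index; lia.
  by left; rewrite -addrA.
case=> rE /(_ _ (transverse_det i)); rewrite -/(next_coord i) => r_dvd.
have -> : w%:Z * l%:Z = r by rewrite width_index rE (det2C v u) abszN; lia.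
by right; rewrite -addrA.
Qed.

(** The coordinates [p] and [q] are both [1] modulo the width, so modulo the index
    [p - 1] and [1 - q] differ by a multiple of the square of the width. An empty residue
    means that the local index divides the width; the index then divides this square. *)
Lemma cone_contribution_no_residue a k : residue u v a = None ->
  cone_contribution k i = 0.
Proof.
rewrite /residue; case: eqP => // /eqP l_dvd _.
apply/eqP; rewrite subr_eq0; apply/eqP/fpart_eqmod.
have lw : (l%:Z %| w%:Z)%Z by rewrite dvdzE.
rewrite -mulrBr dvdz_mull // -width_index.
rewrite (_ : _ - _ = (p * q - 1) + (p - 1) * (1 - q)); last by ring.
apply: rpredD; first exact: coords_inverse.
apply: dvdz_mul; first exact: width_dvd_next.
exact: dvdz_trans lw width_dvd_prev.
Qed.

Lemma cone_contribution_residue r a s k : has_singularity_type u v r a ->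
    residue u v a = Some s -> let c := qs_weight1 s + qs_weight2 s in
  dedekind_sum s (c * (k + 1)) - dedekind_sum s (c * k)
  = ratr (cone_contribution k i).
Proof.
move=> /type_weight wt; rewrite /residue; case: eqP => // /eqP.
set rho := (w %% l)%N => rho_neq0 [<-] /=.
have w_gt0 := width_gt0; have l_gt0 := local_index_gt0.
have rho_gt0 : 0 < rho%:Z :> int by rewrite ltz_nat lt0n.
have w_a : (w%:Z %| a)%Z.
  case: wt => /(dvdz_trans (dvdz_mulr _ (dvdzz w%:Z))) wt.
    have -> : a = (q + a - 1) + (1 - q) by ring.
    exact: rpredD wt width_dvd_prev.
  have -> : a = (p + a - 1) - (p - 1) by ring.
  exact: rpredB wt width_dvd_next.
have /dvdzP[a' aE] := w_a.
have -> : (rho%:Z * a %/ w%:Z)%Z = rho%:Z * a' by rewrite aE mulrA mulzK // gt_eqF.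
have l_dvd : (l%:Z %| w%:Z - rho%:Z)%Z.
  by rewrite -eqz_mod_dvd /rho -modz_nat modz_mod.
have R_gt0 : (0 < rho * l)%N by rewrite -ltz_nat PoszM mulr_gt0.
have pq1 := coords_inverse; have qp1 := pq1; rewrite (mulrC p) in qp1.
rewrite aE (mulrC a') in wt.
set b := rho%:Z * a' - 1; have cE : 1 + b = rho%:Z * a' by rewrite /b; ring.
rewrite mulrDr mulr1 cE (mulrC _ k) -[X in dedekind_sum _ (_ + X)]cE.
rewrite /cone_contribution -width_index.
case: wt => wt.
  have [b_inv fq _ fp _] := residue_fparts k w_gt0 rho_gt0 l_dvd qp1 wt.
  by rewrite (dedekind_sum_step R_gt0 b_inv) fp fq.
have [b_inv _ fp _ fq] := residue_fparts k w_gt0 rho_gt0 l_dvd pq1 wt.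
by rewrite (dedekind_sum_step' R_gt0 b_inv) fp fq.
Qed.

End Cone.

Lemma dedekind_sum_periodic s (m t : int) : (0 < qs_order s)%N ->
  dedekind_sum s (m + (qs_order s)%:Z * t) = dedekind_sum s m.
Proof.
move=> r_gt0; rewrite /dedekind_sum; congr (_ * _); apply: eq_fsbigr => e.
rewrite inE => -[eR _ _]; congr (_ / _).
rewrite exprzDr; first by rewrite -exprz_exp -exprnP eR exp1rz mulr1.
by rewrite -(unitrX_pos _ r_gt0) eR unitr1.
Qed.

(** The sum telescopes. It starts from the Dedekind sum of index [c], the sum of the
    two weights, which equals the one of index [0] since the contribution of the cone
    to the zeroth multiple of the polygon is [0]. *)
Lemma sum_cone_contributions (X : toric_surface) (i : 'I_(nrays X)) r a k :
    has_singularity_type (ray X i) (ray X (ordS i)) r a ->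
  \sum_(j < k) ratr (cone_contribution j.+1 i) =
  oapp (fun s => dedekind_sum s ((qs_weight1 s + qs_weight2 s) * k.+1%:Z)
                 - dedekind_sum s 0) 0 (residue (ray X i) (ray X (ordS i)) a) :> algC.
Proof.
move=> type_a; case res: residue => [s|] /=; last first.
  by rewrite big1 // => j _; rewrite (cone_contribution_no_residue _ res) rmorph0.
have /= step := fun n => cone_contribution_residue n type_a res; elim: k => [|k IHk].
  have := step 0; rewrite big_ord0 mulr0 add0r => ->.
  by rewrite /cone_contribution !mul0r subrr rmorph0.
rewrite big_ord_recr /= IHk -step addrC.
by rewrite (_ : k.+1%:Z + 1 = k.+2%:Z) ?addrA ?subrK //; lia.
Qed.

Lemma residue_order_gt0 (X : toric_surface) (i : 'I_(nrays X)) a s :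
  residue (ray X i) (ray X (ordS i)) a = Some s -> (0 < qs_order s)%N.
Proof.
have := local_index_gt0 i; rewrite /residue ltz_nat => l_gt0.
by case: eqP => // /eqP rho_neq0 [<-] /=; rewrite muln_gt0 lt0n rho_neq0.
Qed.

(** * Expansions of rational functions *)

Section Expansion.
Variable F : fieldType.
Implicit Types (c : nat -> F) (p q : {poly F}) (f g : {fraction {poly F}}).

(** Truncating the series reduces the Cauchy product to the product of
    polynomials. *)
Lemma coef_mul_truncation q c N k : (k < N)%N ->
  (q * \poly_(j < N) c j)`_k = \sum_(i < k.+1) q`_i * c (k - i)%N.
Proof.
move=> kN; rewrite coefM; apply: eq_bigr => i _.
by rewrite coef_poly (leq_ltn_trans (leq_subr _ _) kN).
Qed.

Lemma expansion_at0P c p q : q`_0 != 0 ->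
    (forall N k, (k < N)%N -> (q * \poly_(j < N) c j)`_k = p`_k) ->
  expansion_at0 c (p%:F / q%:F).
Proof.
move=> q0 cq; exists p, q; split=> // k.
by rewrite -(coef_mul_truncation _ _ (ltnSn k)) cq.
Qed.

Lemma expansion_at0_add c d f g : expansion_at0 c f -> expansion_at0 d g ->
  expansion_at0 (fun k => c k + d k) (f + g).
Proof.
move=> [p [q [q0 -> cq]]] [p' [q' [q'0 -> dq']]].
have tofrac_neq0 (r : {poly F}) : r`_0 != 0 -> r%:F != 0.
  by apply: contraNneq => /eqP; rewrite tofrac_eq0 => /eqP->; rewrite coef0.
rewrite addf_div ?tofrac_neq0 // -!tofracM -tofracD.
apply: expansion_at0P => [|N k kN]; first by rewrite coef0M mulf_neq0.
rewrite (_ : \poly_(j < N) _ = \poly_(j < N) c j + \poly_(j < N) d j); last first.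
  by apply/polyP => j; rewrite coefD !coef_poly; case: ifP; rewrite ?addr0.
have coef_mul_eq (r a b : {poly F}) :
    (forall j, (j <= k)%N -> a`_j = b`_j) -> (r * a)`_k = (r * b)`_k.
  by move=> ab; rewrite !coefM; apply: eq_bigr => i _; rewrite ab ?leq_subr.
rewrite mulrDr !coefD (mulrC p) -!(mulrA q) [q * (q' * _)]mulrCA (mulrC p').
congr (_ + _); apply: coef_mul_eq => j jk.
  by rewrite (coef_mul_truncation _ _ (leq_ltn_trans jk kN)) cq.
by rewrite (coef_mul_truncation _ _ (leq_ltn_trans jk kN)) dq'.
Qed.

Lemma expansion_at0_zero : expansion_at0 (fun=> 0) (0 : {fraction {poly F}}).
Proof.
exists 0, 1; rewrite coef1 oner_neq0 tofrac0 mul0r; split=> // k.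
by rewrite coef0 big1 // => i _; rewrite mulr0.
Qed.

Lemma eq_expansion_at0 c d f : c =1 d -> expansion_at0 c f -> expansion_at0 d f.
Proof.
move=> cd [p [q [q0 fE cq]]]; exists p, q; split=> // k.
by rewrite -cq; apply: eq_bigr => i _; rewrite cd.
Qed.

Lemma expansion_at0_sum (I : Type) (r : seq I) (c : I -> nat -> F)
    (f : I -> {fraction {poly F}}) :
    (forall i, expansion_at0 (c i) (f i)) ->
  expansion_at0 (fun k => \sum_(i <- r) c i k) (\sum_(i <- r) f i).
Proof.
move=> cf; elim: r => [|i r IHr].
  rewrite big_nil; apply: eq_expansion_at0 expansion_at0_zero => k.
  by rewrite big_nil.
rewrite big_cons; apply: eq_expansion_at0 (expansion_at0_add (cf i) IHr) => k.
by rewrite big_cons.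
Qed.

(** Multiplication by [1 - 'X] takes the differences of consecutive terms, so the
    numerator is found as the third difference of the sequence. *)
Lemma expansion_smooth_part (K2 : F) : let t : {fraction {poly F}} := 'X%:F in
  expansion_at0 (fun k => 1 + K2 * \sum_(j < k) j.+1%:R)
    ((1 + (K2 - 2)%:P%:F * t + t ^+ 2) / (1 - t) ^+ 3).
Proof.
move=> t; pose p : {poly F} := 1 + (K2 - 2)%:P * 'X + 'X^2.
have -> : 1 + (K2 - 2)%:P%:F * t + t ^+ 2 = p%:F.
  by rewrite /t /p !tofracD tofracM tofracXn tofrac1.
have -> : (1 - t) ^+ 3 = ((1 - 'X) ^+ 3)%:F.
  by rewrite tofracXn tofracB tofrac1.
apply: expansion_at0P => [|N k kN].
  by rewrite -horner_coef0 !hornerE subr0 expr1n oner_neq0.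
rewrite !exprS expr0 mulr1 -!mulrA !mulrBl !mul1r !coefB !coefXM.
rewrite !coefB !coefXM !coef_poly kN /p !coefD coef1 coefCM coefX coefXn.
case: k kN => [|[|[|k]]] kN /=.
all: rewrite ?coefN ?coefXM /= ?coef_poly.
all: rewrite ?(ltnW kN) ?(ltnW (ltnW kN)) ?(ltnW (ltnW (ltnW kN))).
all: rewrite ?big_ord_recr ?big_ord0 /=.
all: by ring.
Qed.

Lemma expansion_periodic (r : nat) (c : nat -> F) : (0 < r)%N ->
    (forall k, c (k + r)%N = c k) ->
  expansion_at0 c ((\sum_(i < r) c i *: 'X^i)%:F / (1 - 'X^r)%:F).
Proof.
move=> r_gt0 c_per; apply: expansion_at0P => [|N k kN].
  by rewrite coefB coef1 coefXn (ltn_eqF r_gt0) subr0 oner_neq0.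
rewrite mulrBl mul1r coefB coefXnM -poly_def !coef_poly kN.
case: ltnP => [|rk]; first by rewrite subr0.
by rewrite (leq_ltn_trans (leq_subr _ _) kN) -{1}(subnK rk) c_per subrr.
Qed.

End Expansion.

(** * The Hilbert series *)

Lemma expansion_Qpart s : (0 < qs_order s)%N ->
  expansion_at0
    (fun k => dedekind_sum s ((qs_weight1 s + qs_weight2 s) * k.+1%:Z)
              - dedekind_sum s 0)
    (Qpart s).
Proof.
move=> r_gt0; apply: expansion_periodic => // k; congr (_ - _).
rewrite -addSn PoszD mulrDr [X in _ + X]mulrC.
exact: dedekind_sum_periodic.
Qed.

Theorem corollary3p5 (X : toric_surface) (n : nat)
    (B : seq quotient_singularity)
    (HB : singularity_content X n B)
    (K_nef : nef (- canonical_divisor X)) :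
  let K := canonical_divisor X in
  let K2 : algC := ratr (intersection K K) in
  let t : {fraction {poly algC}} := 'X%:F in
  expansion_at0 (fun k => (hilbert_coef (- K) k)%:R)
    ((1 + (K2 - 2)%:P%:F * t + t ^+ 2) / (1 - t) ^+ 3
     + \sum_(s <- B) Qpart s).
Proof.
move=> K K2 t; have [r [a [type_a _ ->]]] := HB.
pose contribution (i : 'I_(nrays X)) (k : nat) : algC :=
  \sum_(j < k) ratr (cone_contribution j.+1 i).
have hilbE k : 1 + K2 * (\sum_(j < k) j.+1%:R) + \sum_i contribution i k
    = (hilbert_coef (- K) k)%:R.
  rewrite /hilbert_coef -(ratr_nat algC) h0_cone_contributions; last first.
    exact: nef_anticanonical.
  rewrite /K2 /K; move: (intersection _ _) => KK.
  rewrite !rmorphD rmorphM rmorph1 !rmorph_sum /=; congr (_ + _ * _ + _).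
    by apply: eq_bigr => j _; rewrite ratr_nat.
  by apply: eq_bigr => i _; rewrite rmorph_sum.
apply: (eq_expansion_at0 hilbE).
apply: expansion_at0_add; first exact: expansion_smooth_part.
rewrite big_pmap big_enum; apply: expansion_at0_sum => i.
rewrite /contribution; apply: eq_expansion_at0 => [k|].
  by rewrite (sum_cone_contributions k (type_a i)).
case res_i: (residue _ _ _) => [s|] /=; last exact: expansion_at0_zero.
exact: expansion_Qpart (residue_order_gt0 res_i).
Qed.
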